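(* Let $G=(V,E)$ be a simple undirected graph with $V=[d]$, let $\lambda:E\to[r]$ be an edge coloring, and consider the colored signed Laplacian-constrained Gaussian graphical model (RCON constraints) with natural parameter $\omega=(\omega_1,\dots,\omega_r)\in\Omega$. Its information matrix $I(\omega)\in\mathbb{R}^{r\times r}$ has entries $$I(\omega)_{ij}=\frac18\sum_{uv\in E:\,\lambda(uv)=i}\ \sum_{st\in E:\,\lambda(st)=j}\bigl(\Gamma_{sv}(\omega)-\Gamma_{us}(\omega)-\Gamma_{tv}(\omega)+\Gamma_{ut}(\omega)\bigr)^2,\qquad i,j\in[r].$$
   Context: Notation: $[d]=\{1,\dots,d\}$; $\mathbf{1}$ is the all-ones vector; $\mathcal{H}^{d-1}=\{\mathbf{x}\in\mathbb{R}^d:\mathbf{x}^T\mathbf{1}=0\}$; $\mathbb{S}^d_0$ is the space of symmetric real $d\times d$ matrices with zero diagonal. Edges are undirected; each edge $uv=\{u,v\}$ occurs once in each sum over $E$. Signed Laplacian-constrained Gaussian model: for $Q\in\mathbb{S}^d_0$ let $D$ be diagonal with $D_{ii}=\sum_{j\ne i}Q_{ij}$ and $\Theta=D-Q$ (signed Laplacian). Let $\mathcal{Q}$ be the set of $Q\in\mathbb{S}^d_0$ for which $\Theta$ is positive definite on $\mathcal{H}^{d-1}$ (equivalently, the density below is integrable). The model is the degenerate Gaussian distribution on $\mathcal{H}^{d-1}$ with fixed mean $\mu\in\mathcal{H}^{d-1}$ and density proportional to $\operatorname{Det}(\Theta)^{1/2}\exp(-\tfrac12(\mathbf{w}-\mu)^T\Theta(\mathbf{w}-\mu))$,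 where $\operatorname{Det}$ is the product of the nonzero eigenvalues. It is an exponential family with natural parameter $Q$ and mean parameter $-\Gamma/2$, where $\Gamma=d_\Sigma\mathbf{1}^T+\mathbf{1}d_\Sigma^T-2\Sigma$, with $\Sigma=\Theta^+$ (Moore–Penrose pseudo-inverse) and $d_\Sigma$ the vector of diagonal entries of $\Sigma$. Colored (RCON) model: for $\omega\in\mathbb{R}^r$ define $Q(\omega)\in\mathbb{S}^d_0$ by $Q(\omega)_{uv}=\omega_i$ if $uv\in E$ and $\lambda(uv)=i$, and $Q(\omega)_{uv}=0$ if $uv\notin E$. Let $\Omega=\{\omega\in\mathbb{R}^r:Q(\omega)\in\mathcal{Q}\}$, and let $\Gamma(\omega)$ be the matrix $\Gamma$ corresponding to $Q(\omega)$. Given a sample variogram $\widetilde\Gamma\in\mathbb{S}_0^d$, put $t_i(\widetilde\Gamma)=-\tfrac12\sum_{uv\in E:\lambda(uv)=i}\widetilde\Gamma_{uv}$ and define the (normalized) log-likelihood $$\ell(\omega;\mathbf{t}(\widetilde\Gamma))=\tfrac12\log\Bigl(\sum_{T\in\mathcal{T}}\prod_{uv\in T}Q(\omega)_{uv}\Bigr)+\sum_{i=1}^r t_i(\widetilde\Gamma)\,\omega_i,$$ where $\mathcal{T}$ is the set of spanning trees (of the complete graph on $[d]$, or equivalently of $G$). The information matrix is the negative Hessian of the log-likelihood, $I(\omega)_{ij}=-\dfrac{\partial^2}{\partial\omega_i\partial\omega_j}\ell(\omega;\mathbf{t}(\widetilde\Gamma))$ (which does not depend on $\widetilde\Gamma$).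 *)

(* Defs.v *)
From HB Require Import structures.
From mathcomp Require Import all_boot all_order all_algebra.
From mathcomp Require Import all_classical all_reals all_analysis.

Set Implicit Arguments.
Unset Strict Implicit.
Unset Printing Implicit Defensive.

Import Order.TTheory GRing.Theory Num.Theory.
Import numFieldNormedType.Exports.

Local Open Scope classical_set_scope.
Local Open Scope ring_scope.

(* A graph on [d] is given by its set of edges, each edge uv being the
   unordered pair [set u; v]. *)
Definition simple_graph (d : nat) (E : {set {set 'I_d}}) : bool :=
  [forall e in E, #|e| == 2%N].

Definition edge (d : nat) (p : 'I_d * 'I_d) : {set 'I_d} :=
  [set p.1; p.2]%SET.

(* Each undirected edge is represented by exactly one ordered pair (u, v),
   the one with u < v, so that sums and products over [edges E] count every
   edge once. *)
Definition edges (d : nat) (E : {set {set 'I_d}}) : {set 'I_d * 'I_d} :=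
  [set p : 'I_d * 'I_d | (p.1 < p.2)%N && (edge p \in E)]%SET.

Definition adjacent (d : nat) (T : {set {set 'I_d}}) : rel 'I_d :=
  fun u v => (u != v) && (edge (u, v) \in T).

(* Closed walks u, v, u back and forth along one edge are ucycles of size 2,
   hence the bound 2 for graph-theoretic cycles. *)
Definition acyclic (d : nat) (T : {set {set 'I_d}}) : Prop :=
  forall c : seq 'I_d, ucycleb (adjacent T) c -> (size c <= 2)%N.

(* Spanning trees of the complete graph on [d]. *)
Definition spanning_tree (d : nat) (T : {set {set 'I_d}}) : bool :=
  [&& simple_graph T, [forall u, forall v, connect (adjacent T) u v]
    & `[< acyclic T >]].

Section SignedLaplacianModel.
Context {R : realType} {d : nat}.

Definition sym0 : set 'M[R]_d :=
  [set Q | Q^T = Q /\ forall i, Q i i = 0].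

Definition laplacian (Q : 'M[R]_d) : 'M[R]_d :=
  diag_mx (\row_i \sum_(j | j != i) Q i j) - Q.

Definition hyperplane : set 'cV[R]_d :=
  [set x | x^T *m (const_mx 1 : 'cV[R]_d) = 0].

Definition posdef_on_hyperplane (A : 'M[R]_d) : Prop :=
  forall x, hyperplane x -> x != 0 -> 0 < (x^T *m A *m x) 0 0.

Definition calQ : set 'M[R]_d :=
  [set Q | sym0 Q /\ posdef_on_hyperplane (laplacian Q)].

Definition moore_penrose (A B : 'M[R]_d) : Prop :=
  [/\ A *m B *m A = A, B *m A *m B = B,
      (A *m B)^T = A *m B & (B *m A)^T = B *m A].

(* The default value 0 is never used, see [mp_inverseP]. *)
Definition mp_inverse (A : 'M[R]_d) : 'M[R]_d :=
  xget 0 [set B | moore_penrose A B].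

Lemma moore_penrose_unique (A B C : 'M[R]_d) :
  moore_penrose A B -> moore_penrose A C -> B = C.
Proof.
move=> [B1 B2 B3 B4] [C1 C2 C3 C4].
have AB : A *m B = A *m C.
  by rewrite -{1}C1 -mulmxA -C3 -B3 -trmx_mul mulmxA B1.
have BA : B *m A = C *m A.
  by rewrite -{1}C1 mulmxA (mulmxA B) -(mulmxA (B *m A)) -B4 -C4 -trmx_mul
             -mulmxA (mulmxA A) B1.
by rewrite -B2 BA -mulmxA AB mulmxA C2.
Qed.

Lemma gram_unit m n (F : 'M[R]_(m, n)) : row_free F -> F *m F^T \in unitmx.
Proof.
move=> freeF; rewrite -row_free_unit -kermx_eq0; apply/rowV0P => v.
move/sub_kermxP => vFF0.
have vF0 : v *m F = 0.
  have : (v *m F) *m (v *m F)^T = 0 by rewrite trmx_mul mulmxA -(mulmxA v) vFF0 mul0mx.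
  move/matrixP/(_ 0 0); rewrite !mxE => /eqP.
  rewrite psumr_eq0 => [/allP s0|k _]; last by rewrite !mxE -expr2 sqr_ge0.
  apply/rowP => k; have := s0 k (mem_index_enum k).
  by rewrite /= !mxE mulf_eq0 orbb => /eqP.
by apply: (row_free_inj freeF); rewrite vF0 mul0mx.
Qed.

Lemma mp_inverseP (A : 'M[R]_d) : moore_penrose A (mp_inverse A).
Proof.
rewrite /mp_inverse; apply: (@xgetPex _ _ [set B | moore_penrose A B]).
have : row_free (row_base A) := row_base_free A.
have : row_free (col_base A)^T by rewrite /row_free mxrank_tr; exact: col_base_full.
have := mulmx_base A.
move: (\rank A) (col_base A) (row_base A) => k C F defA freeC freeF.
have uF : F *m F^T \in unitmx by exact: gram_unit.
have uC : C^T *m C \in unitmx by rewrite -{2}(trmxK C); exact: gram_unit.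
pose L := invmx (C^T *m C) *m C^T; pose P := F^T *m invmx (F *m F^T).
have LC : L *m C = 1%:M by rewrite /L -mulmxA mulVmx.
have FP : F *m P = 1%:M by rewrite /P mulmxA mulmxV.
have AB : A *m (P *m L) = C *m L.
  by rewrite -defA mulmxA -(mulmxA C) FP mulmx1.
have BA : (P *m L) *m A = P *m F.
  by rewrite -defA mulmxA -(mulmxA P) LC mulmx1.
exists (P *m L); split.
- by rewrite AB -defA mulmxA -(mulmxA C) LC mulmx1.
- by rewrite BA mulmxA -(mulmxA P) FP mulmx1.
- by rewrite AB /L !trmx_mul trmx_inv trmx_mul !trmxK mulmxA.
- by rewrite BA /P !trmx_mul trmx_inv trmx_mul !trmxK mulmxA.
Qed.

Definition variogram (Q : 'M[R]_d) : 'M[R]_d :=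
  let Sigma := mp_inverse (laplacian Q) in
  let dSigma : 'cV[R]_d := \col_i Sigma i i in
  let one : 'cV[R]_d := const_mx 1 in
  dSigma *m one^T + one *m dSigma^T - Sigma *+ 2.

End SignedLaplacianModel.

Section ColoredModel.
Context {R : realType} {d r : nat}.

(* Only the values of the coloring [lam] on the elements of [E] matter. *)
Variables (E : {set {set 'I_d}}) (lam : {set 'I_d} -> 'I_r).

Definition Qmx (omega : 'rV[R]_r) : 'M[R]_d :=
  \matrix_(u, v) if edge (u, v) \in E then omega 0 (lam (edge (u, v))) else 0.

Definition Omega : set 'rV[R]_r := [set omega | calQ (Qmx omega)].

Definition Gamma (omega : 'rV[R]_r) : 'M[R]_d := variogram (Qmx omega).

Definition tstat (Gt : 'M[R]_d) : 'rV[R]_r :=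
  \row_i - (2^-1 * \sum_(p in edges E | lam (edge p) == i) Gt p.1 p.2).

Definition loglik (t omega : 'rV[R]_r) : R :=
  2^-1 * ln (\sum_(T : {set {set 'I_d}} | spanning_tree T)
               \prod_(p in edges T) Qmx omega p.1 p.2)
  + \sum_(i < r) t 0 i * omega 0 i.

Definition hessian (f : 'rV[R]_r -> R) (omega : 'rV[R]_r) : 'M[R]_r :=
  \matrix_(i, j) 'D_(delta_mx 0 i) ('D_(delta_mx 0 j) f) omega.

Definition information (Gt : 'M[R]_d) (omega : 'rV[R]_r) : 'M[R]_r :=
  - hessian (loglik (tstat Gt)) omega.

End ColoredModel.

(* Main.v *)
(* By the weighted matrix-tree theorem the sum over spanning trees is the
   determinant of the grounded Laplacian M, the Laplacian Theta with the row of
   one vertex replaced by a unit vector.  M is affine in omega, say with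
   derivative B_i in direction i, so that the information is
   1/2 tr (M^-1 B_i M^-1 B_j).  Each B_i is a sum of rank-one terms P b b^T,
   where P erases the grounded row and b = e_u - e_v, and
   b^T M^-1 P c = b^T Sigma c for all b, c orthogonal to the ones vector.  Hence
   the trace is the sum of the (b^T Sigma c)^2, and 2 b^T Sigma c is the
   combination of the four entries of Gamma. *)
Require Import Defs.
From mathcomp Require Import all_boot all_order all_algebra fingroup perm.
From mathcomp Require Import all_classical all_reals all_analysis.
From mathcomp Require Import ring lra.

Set Implicit Arguments.
Unset Strict Implicit.
Unset Printing Implicit Defensive.

Import Order.TTheory GRing.Theory Num.Theory.
Import numFieldNormedType.Exports.

Local Open Scope classical_set_scope.
Local Open Scope ring_scope.

Lemma edge_sym d (u v : 'I_d) : edge (u, v) = edge (v, u).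
Proof. exact: finset.setUC. Qed.

(** * Spanning trees as parent maps, and the weighted matrix-tree theorem *)

Section RootedMaps.
Variable n : nat.
Notation V := 'I_n.+1.
Implicit Types (f g : {ffun V -> V}) (T : {set {set V}}) (u v : V).

(** [f] is read as a parent map: [f u] is the next vertex on the way from [u] to the root [ord0].
    Making the root a fixed point leaves exactly one such map per spanning tree. *)
Definition rooted f := (f ord0 == ord0) && [forall u, fconnect f u ord0].

Definition tree_of f : {set {set V}} :=
  [set edge (u, f u) | u in [set~ ord0]]%SET.

Lemma edge_inj u v x y : edge (u, v) = edge (x, y) ->
  (u = x /\ v = y) \/ (u = y /\ v = x).
Proof.
rewrite /edge /= => /setP e.
have := e u; have := e v; have := e x; have := e y; rewrite !inE !eqxx ?orbT.
move=> /orP[]/eqP yE /orP[]/eqP xE /esym/orP[]/eqP vE /esym/orP[]/eqP uE;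
  by [left; split; congruence | right; split; congruence].
Qed.

Lemma adjacent_sym T : symmetric (Defs.adjacent T).
Proof. by move=> u v; rewrite /Defs.adjacent eq_sym edge_sym. Qed.

(** [findex f u ord0] is the depth of [u]. Its decrease from child to parent drives the acyclicity,
    injectivity and determinant arguments below. *)
Lemma depth_lt f u : rooted f -> u != ord0 ->
  (findex f (f u) ord0 < findex f u ord0)%N.
Proof.
move=> /andP[_ /forallP cf] u0.
by rewrite (fconnect_findex (cf u)) // eq_sym.
Qed.

Lemma rooted_neq f u : rooted f -> u != ord0 -> f u != u.
Proof. by move=> rf u0; apply: contraTneq (depth_lt rf u0) => ->; rewrite ltnn. Qed.

(** Each of the two would be strictly deeper than the other. Hence distinct non-root vertices have
    distinct parent edges. *)
Lemma rooted_asym f u v : rooted f -> u != ord0 -> v != ord0 ->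
  f u = v -> f v <> u.
Proof.
move=> rf u0 v0 fu fv; have := depth_lt rf u0; have := depth_lt rf v0.
by rewrite fu fv => /ltnW; rewrite leqNgt => /negbTE ->.
Qed.

Lemma edge_tree_of f u : u != ord0 -> edge (u, f u) \in tree_of f.
Proof. by move=> u0; apply: imset_f; rewrite !inE. Qed.

Lemma edge_tree_ofP f u v : edge (u, v) \in tree_of f ->
  (u != ord0 /\ f u = v) \/ (v != ord0 /\ f v = u).
Proof.
move=> /imsetP[w]; rewrite !inE => w0 /edge_inj[[-> ->]|[-> ->]].
  by left. by right.
Qed.

Lemma simple_tree_of f : rooted f -> simple_graph (tree_of f).
Proof.
move=> rf; apply/forall_inP => e /imsetP[u]; rewrite !inE => u0 ->.
by rewrite /edge cards2 [u == _]eq_sym rooted_neq.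
Qed.

Lemma connect_tree_of f u v : rooted f -> connect (Defs.adjacent (tree_of f)) u v.
Proof.
move=> rf; suff to_root w : connect (Defs.adjacent (tree_of f)) w ord0.
  apply: connect_trans (to_root u) _.
  by rewrite (sym_connect_sym (@adjacent_sym _)).
move: {2}(findex f w ord0) (leqnn (findex f w ord0)) => k.
elim: k w => [|k IH] w wk.
  by move: wk; rewrite leqn0 findex_eq0 => /eqP ->.
have [->|w0] := eqVneq w ord0; first exact: connect0.
apply: connect_trans (connect1 _) (IH (f w) _).
  by rewrite /Defs.adjacent eq_sym rooted_neq // edge_tree_of.
by rewrite -ltnS (leq_trans (depth_lt rf w0)).
Qed.

(* A vertex of a cycle that is farthest from the root has both its cyclic
   neighbours equal to its parent. *)
Lemma acyclic_tree_of f : rooted f -> acyclic (tree_of f).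
Proof.
move=> rf c /andP[cyc uni]; rewrite leqNgt; apply/negP => c3.
have c0 : nth ord0 c 0 \in c by apply: mem_nth; apply: leq_trans c3.
case: (arg_maxnP (fun u => findex f u ord0) c0) => u uc umax.
have [i s rot_c] := rot_to uc.
have parent w : w \in c -> Defs.adjacent (tree_of f) u w -> w = f u.
  move=> wc /andP[_ /edge_tree_ofP[[_ ->]//|[w0 fw]]].
  by have := depth_lt rf w0; rewrite fw ltnNge => /negP[]; exact: umax.
have cs w : w \in u :: s -> w \in c by rewrite -rot_c mem_rot.
move: c3 cyc uni; rewrite -(size_rot i) -(rot_cycle i) -(rot_uniq i) rot_c.
case: s cs {rot_c} => [|v [|w s]] // cs _.
rewrite /path.cycle rcons_path [path _ _ (_ :: _)]/= -andbA => /and3P[uv _ lu] uni.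
have lw : last w s \in [:: u, v, w & s] by rewrite 2!in_cons mem_last !orbT.
have lE : last w s = f u by apply: parent (cs _ lw) _; rewrite adjacent_sym.
have vE : v = f u by apply: parent uv; apply: cs; rewrite !inE eqxx orbT.
by move: uni; rewrite !cons_uniq => /and3P[_ /negP[]]; rewrite vE -lE mem_last.
Qed.

Lemma spanning_tree_of f : rooted f -> spanning_tree (tree_of f).
Proof.
move=> rf; apply/and3P; split; first exact: simple_tree_of.
  by apply/forallP => u; apply/forallP => v; exact: connect_tree_of.
by apply/asboolP; exact: acyclic_tree_of.
Qed.

(** Induction on the depth of [u] under [f]. The parent edge of [u] lies in [tree_of g], so
    [g u = f u] or [g (f u) = u]; in the second case the induction hypothesis at [f u] makes [u] and
    [f u] each other's parent under [f]. *)
Lemma tree_of_inj : {in rooted &, injective tree_of}.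
Proof.
move=> f g rf rg fg; apply/ffunP => u.
move: {2}(findex f u ord0) (leqnn (findex f u ord0)) => k.
have [/andP[/eqP f0 _] /andP[/eqP g0 _]] := (rf, rg).
elim: k u => [|k IH] u uk.
  by move: uk; rewrite leqn0 findex_eq0 => /eqP ->; rewrite f0 g0.
have [->|u0] := eqVneq u ord0; first by rewrite f0 g0.
have := edge_tree_of f u0; rewrite fg => /edge_tree_ofP[[_ ->//]|[fu0 gfu]].
have ffu : f (f u) = g (f u).
  by apply: IH; rewrite -ltnS (leq_trans (depth_lt rf u0)).
by case: (rooted_asym rf u0 fu0 erefl); rewrite ffu.
Qed.

(** Take for [d u] the length of a shortest path to the root; the second vertex of that path is
    closer. *)
Lemma exists_distance T : (forall u, connect (Defs.adjacent T) u ord0) ->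
  exists d : V -> nat, forall u, u != ord0 ->
    exists v, Defs.adjacent T u v && (d v < d u)%N.
Proof.
move=> cT.
pose P u k := `[< exists p, [/\ path (Defs.adjacent T) u p, last u p = ord0
                              & size p = k] >].
have exP u : exists k, P u k.
  by have /connectP[p pp lp] := cT u; exists (size p); apply/asboolP; exists p.
exists (fun u => ex_minn (exP u)) => u u0.
case: ex_minnP => k /asboolP[[|v p] [/= pp lp <-]] _.
  by rewrite /= in lp; move: u0; rewrite lp eqxx.
move: pp => /andP[uv pp]; exists v; rewrite uv; case: ex_minnP => m _ mmin.
by rewrite ltnS mmin //; apply/asboolP; exists p.
Qed.

(* An edge of [T] outside the tree of parents would close a cycle with the
   path joining its ends in that tree. *)
Lemma tree_of_surj T : spanning_tree T -> exists2 f, rooted f & tree_of f = T.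
Proof.
move=> /and3P[/forall_inP simT /forallP cT /asboolP acT].
have [u|d dP] := @exists_distance T; first exact/forallP.
(* The parent is any neighbour closer to the root; [dP] ensures that [pick] finds one for every
   [u != ord0]. *)
pose f := [ffun u => if u == ord0 then ord0 else
  odflt ord0 [pick v | Defs.adjacent T u v && (d v < d u)%N]].
have f0 : f ord0 = ord0 by rewrite ffunE eqxx.
have fP u : u != ord0 -> Defs.adjacent T u (f u) && (d (f u) < d u)%N.
  move=> u0; rewrite ffunE (negbTE u0); case: pickP => // none.
  by have [v] := dP u u0; rewrite none.
have rf : rooted f.
  rewrite /rooted f0 eqxx; apply/forallP => u.
  move: {2}(d u) (leqnn (d u)) => k; elim: k u => [|k IH] u uk;
    have [->|u0] := eqVneq u ord0; rewrite ?connect0 //;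
    have /andP[_ du] := fP u u0.
    by move: (leq_trans du uk).
  apply: connect_trans (connect1 _) (IH (f u) _); first exact/eqP.
  by rewrite -ltnS (leq_trans du).
have sub : {subset tree_of f <= T}.
  by move=> e /imsetP[u]; rewrite !inE => /fP/andP[/andP[_ eT] _] ->.
exists f => //; apply/setP => e; apply/idP/idP => [/(sub e)//|eT].
have /cards2P[x [y [xy eE]]] := simT e eT.
apply/negPn/negP => eNf.
have /connectP[p0 pp0 yE] := connect_tree_of x y rf.
case/shortenP: pp0 yE => p pp up _ yE.
(* A simple path of length 0 contradicts [x != y], one of length 1 puts [e] in the tree, and a
   longer one closes up with [e] into a cycle on at least three vertices. *)
case: p pp up yE => [|a [|b p]] pp up yE.
- by rewrite yE eqxx in xy.
- by move: eNf; rewrite eE yE; move: pp => /= /andP[/andP[_ ->]].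
have /acT : ucycleb (Defs.adjacent T) [:: x, a, b & p].
  rewrite /ucycleb up andbT /path.cycle rcons_path -yE; apply/andP; split.
    apply: sub_path pp => u v /andP[uv]; rewrite /Defs.adjacent uv.
    exact: sub.
  by rewrite adjacent_sym /Defs.adjacent xy /edge -eE.
by [].
Qed.

Lemma rooted_tree_ofE :
  [set T | spanning_tree T]%SET = [set tree_of f | f in rooted]%SET.
Proof.
apply/setP => T; rewrite inE; apply/idP/imsetP => [/tree_of_surj[f rf <-]|].
  by exists f.
by move=> [f rf ->]; exact: spanning_tree_of.
Qed.

(** Every tree edge is the parent edge of exactly one non-root vertex. [edges] orients it from the
    smaller to the larger end, [f] from child to parent; symmetry of [Q] absorbs the difference. *)
Lemma prod_tree_of (R : comNzRingType) (Q : 'M[R]_n.+1) f :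
    rooted f -> Q^T = Q ->
  \prod_(p in edges (tree_of f)) Q p.1 p.2 = \prod_(u | u != ord0) Q u (f u).
Proof.
move=> rf /matrixP symQ.
pose h u := if (u < f u)%N then (u, f u) else (f u, u).
have edge_h u : edge (h u) = edge (u, f u).
  by rewrite /h; case: ifP => // _; exact: edge_sym.
have h_edges u : u != ord0 -> h u \in edges (tree_of f).
  move=> u0; rewrite inE edge_h edge_tree_of // andbT /h.
  case: (ltnP u (f u)) => //= fu; rewrite ltn_neqAle fu andbT.
  exact: rooted_neq rf u0.
have h_inj : {in [set~ ord0]%SET &, injective h}.
  move=> u v; rewrite !inE => u0 v0 huv.
  have := edge_h u; rewrite huv edge_h => /esym/edge_inj[[]//|[uE fuE]].
  by case: (rooted_asym rf u0 v0 fuE).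
have -> : edges (tree_of f) = [set h u | u in [set~ ord0]]%SET.
  apply/setP => p; apply/idP/imsetP => [|[u]]; last first.
    by rewrite !inE => u0 ->; have := h_edges u u0; rewrite inE.
  case: p => x y; rewrite inE /= => /andP[xy /edge_tree_ofP[]] [u0 fu].
    by exists x; rewrite ?inE // /h fu xy.
  by exists y; rewrite ?inE // /h fu ltnNge ltnW.
rewrite big_imset //=; apply: eq_big => [u|u _]; first by rewrite !inE.
by rewrite /h; case: ifP => // _; rewrite -[LHS]symQ mxE.
Qed.

(* A permutation contributing to the determinant either fixes a vertex or moves
   it to its parent; as it preserves the total distance to the root, it is the
   identity. *)
Lemma det_rooted (R : comNzRingType) f : rooted f ->
  \det (\matrix_(u, v) ((u == v)%:R - ((u != ord0) && (f u == v))%:R)) = 1 :> R.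
Proof.
move=> rf; rewrite /determinant (bigD1 (1%g : 'S_n.+1)) //= odd_perm1 mul1r.
rewrite [X in _ + X]big1 ?addr0 => [|s s1].
  apply: big1 => u _; rewrite mxE perm1 eqxx.
  have [//|u0] := eqVneq u ord0; first by rewrite subr0.
  by rewrite (negbTE (rooted_neq rf u0)) subr0.
pose dep u := findex f u ord0.
have [/existsP[u /andP[su fu]]|] :=
  boolP [exists u, (s u != u) && ~~ ((u != ord0) && (f u == s u))].
  by rewrite (bigD1 u) //= mxE eq_sym (negbTE su) (negbTE fu) subr0 mul0r mulr0.
rewrite negb_exists => /forallP moves.
have dep_s u : (dep (s u) <= dep u ?= iff (s u == u))%N.
  have := moves u; rewrite negb_and !negbK.
  have [-> _|_ /= /andP[u0 /eqP <-]] := eqVneq (s u) u; first by split; rewrite ?eqxx.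
  have lt := depth_lt rf u0; split; first exact: ltnW.
  by rewrite ltn_eqF // (negbTE (rooted_neq rf u0)).
have := leqif_sum (fun u (_ : true) => dep_s u).
have dep_sum : (\sum_u dep (s u) = \sum_u dep u)%N.
  by rewrite [RHS](reindex_inj (@perm_inj _ s)).
rewrite /= dep_sum => -[_]; rewrite eqxx => /esym/forallP fix_s.
case/eqP: s1; apply/permP => u; rewrite perm1; exact/eqP/fix_s.
Qed.

(** The indicator [lost] of the vertices that never reach the root is a nonzero kernel vector: it
    vanishes at the root, and a non-root vertex is lost exactly when its image is. *)
Lemma det_not_rooted (R : idomainType) f : f ord0 = ord0 -> ~~ rooted f ->
  \det (\matrix_(u, v) ((u == v)%:R - ((u != ord0) && (f u == v))%:R)) = 0 :> R.
Proof.
move=> f0; rewrite /rooted f0 eqxx negb_forall => /existsP[u0 Nu0].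
pose lost u : R := (~~ fconnect f u ord0)%:R.
apply/eqP; rewrite -det_tr; apply/det0P; exists (\row_u lost u).
  apply/negP => /eqP/rowP/(_ u0)/eqP; rewrite !mxE /lost Nu0.
  by rewrite oner_eq0.
apply/rowP => u; rewrite !mxE.
under eq_bigr => v _ do rewrite !mxE mulrBr.
rewrite sumrB (bigD1 u) //= eqxx mulr1 big1 ?addr0 => [|v vu]; last first.
  by rewrite eq_sym (negbTE vu) mulr0.
have [->|uN0] := eqVneq u ord0.
  by rewrite /lost connect0 big1 ?subrr // => v _; rewrite /= mulr0.
rewrite (bigD1 (f u)) //= eqxx mulr1 big1 ?addr0 => [|v vu]; last first.
  by rewrite eq_sym (negbTE vu) mulr0.
suff -> : lost u = lost (f u) by rewrite subrr.
congr (~~ _)%:R; apply/idP/idP => cu; last first.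
  by apply: connect_trans cu; apply: connect1; exact/eqP.
move: (iter_findex cu) uN0; rewrite -(findex_eq0 f).
by case: (findex f u ord0) => // k; rewrite iterSr => <-; rewrite fconnect_iter.
Qed.

(** Multilinearity in all rows at once: [f] records the summand chosen in each row. *)
Lemma det_sum_rows (R : comNzRingType) m (J : finType)
    (W : 'I_m -> J -> R) (B : 'I_m -> J -> 'I_m -> R) :
  \det (\matrix_(u, v) \sum_w W u w * B u w v) =
  \sum_(f : {ffun 'I_m -> J})
    (\prod_u W u (f u)) * \det (\matrix_(u, v) B u (f u) v).
Proof.
under [RHS]eq_bigr => f _ do rewrite /determinant mulr_sumr.
rewrite exchange_big; apply: eq_bigr => s _ /=.
under eq_bigr => u _ do rewrite mxE.
rewrite bigA_distr_bigA mulr_sumr; apply: eq_bigr => f _.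
rewrite big_split /= mulrCA; congr (_ * (_ * _)).
by apply: eq_bigr => u _; rewrite mxE.
Qed.

(** Its determinant is that of the Laplacian with the root row and column deleted, but the dimension
    stays that of the Laplacian. *)
Definition grounded_laplacian (R : realType) (Q : 'M[R]_n.+1) : 'M[R]_n.+1 :=
  \matrix_(u, v) if u == ord0 then (v == ord0)%:R else laplacian Q u v.

(* Expanding every row [u != 0] of the grounded Laplacian as
   [\sum_w Q u w *: (e_u - e_w)] turns its determinant into a sum over maps
   [f], each rooted [f] contributing the weight of its tree. *)
Lemma matrix_tree (R : realType) (Q : 'M[R]_n.+1) : sym0 Q ->
  \sum_(T : {set {set V}} | spanning_tree T) \prod_(p in edges T) Q p.1 p.2 =
  \det (grounded_laplacian Q).
Proof.
move=> [symQ Q0].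
(* The root row of [W] is supported at [ord0], so only maps that fix the root survive the
   expansion. *)
pose W (u w : V) : R := if u == ord0 then (w == ord0)%:R else Q u w.
pose B (u w v : V) : R := (u == v)%:R - ((u != ord0) && (w == v))%:R.
have -> : grounded_laplacian Q = \matrix_(u, v) \sum_w W u w * B u w v.
  apply/matrixP => u v; rewrite !mxE /W /B.
  case: eqVneq => [->|u0] /=.
    rewrite (bigD1 ord0) //= big1 => [|w /negbTE->]; last by rewrite mul0r.
    by rewrite addr0 mul1r subr0 eq_sym.
  under [RHS]eq_bigr => w _ do rewrite mulrBr.
  rewrite [RHS]sumrB; congr (_ - _).
    rewrite -mulr_suml [in RHS](bigD1 u) //= Q0 add0r.
    by rewrite mulr_natr; congr (_ *+ _).
  rewrite (bigD1 v) //= eqxx mulr1 big1 ?addr0 // => w /negbTE ->.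
  by rewrite mulr0.
rewrite (det_sum_rows W B) -big_set rooted_tree_ofE.
rewrite big_imset /=; last exact: tree_of_inj.
rewrite [RHS](bigID rooted) /= [X in _ = _ + X]big1 ?addr0.
  apply: eq_bigr => f rf; rewrite det_rooted // mulr1 prod_tree_of //.
  rewrite [RHS](bigD1 ord0) //= {1}/W eqxx.
  case/andP: (rf) => -> _; rewrite mul1r.
  by apply: eq_bigr => u /negbTE u0; rewrite /W u0.
move=> f Nrf; have [f0|f0] := eqVneq (f ord0) ord0.
  by rewrite det_not_rooted ?mulr0.
by rewrite (bigD1 ord0) //= {1}/W eqxx (negbTE f0) !mul0r.
Qed.

End RootedMaps.

(** * Derivatives of determinants and inverses along a line of matrices *)

Lemma deriv_prod_seq (A : comNzRingType) (I : eqType) (s : seq I)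
    (p : I -> {poly A}) : uniq s ->
  ((\prod_(i <- s) p i)^`())%R =
  \sum_(i <- s) ((p i)^`())%R * \prod_(j <- s | j != i) p j.
Proof.
elim: s => [|x s IH] /=; first by rewrite !big_nil -polyC1 derivC.
move=> /andP[xs us]; rewrite !big_cons derivM IH // eqxx /=.
congr (_ * _ + _).
  rewrite [LHS]big_seq [RHS]big_seq_cond; apply: eq_bigl => j.
  by have [->|//] := eqVneq j x; rewrite ?(negbTE xs) ?andbT.
rewrite mulr_sumr [LHS]big_seq [RHS]big_seq; apply: eq_bigr => i si.
rewrite big_cons; have -> /= : x != i by apply: contraNneq xs => ->.
by rewrite mulrCA.
Qed.

(** Jacobi's formula: the Leibniz rule differentiates one row at a time, and expansion along that
    row produces the cofactors. *)
Lemma deriv_det (A : comNzRingType) n (P : 'M[{poly A}]_n) :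
  ((\det P)^`())%R = \tr (map_mx (@deriv A) P *m \adj P).
Proof.
have deriv_sign (b : bool) (p : {poly A}) :
    (((-1) ^+ b * p)^`())%R = (-1) ^+ b * (p^`())%R.
  by case: b; rewrite ?mulN1r ?mul1r ?derivN.
pose P' i : 'M[{poly A}]_n :=
  \matrix_(k, l) (if k == i then ((P k l)^`())%R else P k l).
transitivity (\sum_i \det (P' i)).
  rewrite /determinant raddf_sum exchange_big; apply: eq_bigr => s _ /=.
  rewrite deriv_sign deriv_prod_seq ?index_enum_uniq // mulr_sumr.
  apply: eq_bigr => i _; rewrite [in RHS](bigD1 i) //= mxE eqxx; congr (_ * (_ * _)).
  by apply: eq_bigr => k /negbTE ki; rewrite mxE ki.
rewrite /mxtrace; apply: eq_bigr => i _.
rewrite (expand_det_row _ i) mxE; apply: eq_bigr => j _.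
rewrite !mxE eqxx; congr (_ * ((-1) ^+ _ * \det _)).
by apply/matrixP => k l; rewrite !mxE eq_sym (negbTE (neq_lift _ _)).
Qed.

Section LogDet.
Variable R : realType.

(** Encoding a line of matrices over [{poly R}] makes determinants and adjugates along it
    polynomial, hence continuous and formally differentiable. *)
Definition pencil n (A B : 'M[R]_n) : 'M[{poly R}]_n :=
  map_mx polyC A + 'X *: map_mx polyC B.

Lemma horner_pencil n (A B : 'M[R]_n) x :
  map_mx (horner_eval x) (pencil A B) = A + x *: B.
Proof. by apply/matrixP => i j; rewrite !mxE /horner_eval !hornerE. Qed.

Lemma horner_det_pencil n (A B : 'M[R]_n) x :
  (\det (pencil A B)).[x] = \det (A + x *: B).
Proof. by rewrite -horner_evalE -det_map_mx horner_pencil. Qed.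

Lemma deriv_det_pencil n (A B : 'M[R]_n) : A \in unitmx ->
  ((\det (pencil A B))^`()%R).[0] = \det A * \tr (invmx A *m B).
Proof.
move=> uA; rewrite deriv_det -horner_evalE -trace_map_mx map_mxM map_mx_adj.
rewrite horner_pencil scale0r addr0.
have -> : map_mx (horner_eval 0) (map_mx (@deriv R) (pencil A B)) = B.
  apply/matrixP => i j; rewrite !mxE /horner_eval derivD derivM derivX !derivC.
  by rewrite !hornerE.
by rewrite mxtrace_mulC /invmx uA -scalemxAl mxtraceZ mulrA divff ?mul1r -?unitfE.
Qed.

Lemma det_gt0_near n (A B : 'M[R]_n) : 0 < \det A ->
  \forall x \near (0 : R), 0 < \det (A + x *: B).
Proof.
move=> A0.
have := @continuous_horner R (\det (pencil A B)) 0.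
rewrite /continuous_at horner_det_pencil scale0r addr0 => /cvgr_gt/(_ _ A0).
by apply: filterS => x; rewrite horner_det_pencil.
Qed.

Lemma is_derive_ln_det n (A B : 'M[R]_n) : 0 < \det A ->
  is_derive (0 : R) 1 (fun x : R => ln (\det (A + x *: B))) (\tr (invmx A *m B)).
Proof.
move=> A0.
have uA : A \in unitmx by rewrite unitmxE unitfE gt_eqF.
have -> : (fun x : R => ln (\det (A + x *: B))) =
    (@ln R \o horner (\det (pencil A B))).
  by apply/funext => x /=; rewrite horner_det_pencil.
have p0 : (\det (pencil A B)).[0] = \det A.
  by rewrite horner_det_pencil scale0r addr0.
apply: is_derive_eq.
  apply: is_derive1_comp; apply: is_derive1_ln; by rewrite p0.
by rewrite p0 deriv_det_pencil //= /GRing.scale /= mulrA mulVf ?mul1r ?gt_eqF.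
Qed.

(** By Cramer's rule the trace is, near 0, a quotient of two polynomials whose denominator does not
    vanish at 0. *)
Lemma cvg_tr_inv n (A B C : 'M[R]_n) : 0 < \det A ->
  (fun x : R => \tr (invmx (A + x *: B) *m C)) @ (0 : R) --> \tr (invmx A *m C).
Proof.
move=> A0.
pose q := \tr (\adj (pencil A B) *m map_mx polyC C).
have invE x : 0 < \det (A + x *: B) ->
    (\det (pencil A B)).[x]^-1 * q.[x] = \tr (invmx (A + x *: B) *m C).
  move=> x0; rewrite horner_det_pencil /invmx unitmxE unitfE gt_eqF //=.
  rewrite -scalemxAl mxtraceZ /q -!horner_evalE -trace_map_mx map_mxM map_mx_adj.
  rewrite horner_pencil; congr (_ * \tr (_ *m _)).
  apply/matrixP => i j; rewrite !mxE; exact: hornerC.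
have <- : (\det (pencil A B)).[0]^-1 * q.[0] = \tr (invmx A *m C).
  by rewrite invE scale0r addr0.
apply: (@cvg_trans _ ((fun x => (\det (pencil A B)).[x]^-1 * q.[x]) @ (0 : R))).
  by apply: near_eq_cvg; apply: filterS (det_gt0_near B A0) => x /invE.
have p0 : (\det (pencil A B)).[0] != 0.
  by rewrite horner_det_pencil scale0r addr0 gt_eqF.
have cvg_p := @continuous_horner R (\det (pencil A B)) 0.
have cvg_q := @continuous_horner R q 0.
exact: cvgM (cvgV p0 cvg_p) cvg_q.
Qed.

(** The resolvent identity [(A + xB)^-1 - A^-1 = - x (A + xB)^-1 B A^-1] turns the difference
    quotient into a trace that [cvg_tr_inv] handles, with [K] in place of [C]. *)
Lemma is_derive_tr_inv n (A B C : 'M[R]_n) : 0 < \det A ->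
  is_derive (0 : R) 1 (fun x : R => \tr (invmx (A + x *: B) *m C))
    (- \tr (invmx A *m B *m invmx A *m C)).
Proof.
move=> A0; set f := fun x : R => _; set l := - _.
have A_unit M : 0 < \det M -> (M : 'M[R]_n) \in unitmx.
  by move=> M0; rewrite unitmxE unitfE gt_eqF.
have f'l : (fun h : R => h^-1 *: ((f \o shift 0) (h *: 1) - f 0)) @ 0^' --> l.
  pose K := B *m invmx A *m C.
  apply: (@cvg_trans _ ((fun x => - \tr (invmx (A + x *: B) *m K)) @ 0^')).
    apply: near_eq_cvg; have := nbhs_dnbhs_neq (0 : R).
    have := nbhs_dnbhs (det_gt0_near B A0); apply: filterS2 => x x0 xN0.
    rewrite /f /= addr0 [_ *: 1]mulr1 scale0r addr0 -raddfB -mulmxBl.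
    have -> : invmx (A + x *: B) - invmx A =
        - (x *: (invmx (A + x *: B) *m B *m invmx A)).
      rewrite -{1}(mulmx1 (invmx (A + _))) -(mulmxV (A_unit _ A0)).
      rewrite -[X in _ - X]mul1mx -(mulVmx (A_unit _ x0)) mulmxA -mulmxBl.
      rewrite -mulmxBr opprD addrA subrr add0r mulmxN mulNmx.
      by rewrite -scalemxAr !scalemxAl.
    rewrite mulNmx raddfN -scalemxAl /= mxtraceZ scalerN.
    by rewrite [X in _ = - X]mulrA mulVf // mul1r /K !mulmxA.
  have -> : l = - \tr (invmx A *m K) by rewrite /l /K !mulmxA.
  have cvgK := @cvg_tr_inv _ A B K A0.
  have cvgK' : (fun x => \tr (invmx (A + x *: B) *m K)) @ 0^' -->
      \tr (invmx A *m K) by exact: cvg_within_filter cvgK.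
  exact: cvgN cvgK'.
apply: DeriveDef; first by apply: cvgP f'l.
exact: cvg_lim f'l.
Qed.

End LogDet.

(** * Laplacians, their pseudo-inverses and the variogram *)

Section Laplacian.
Variables (R : realType) (d : nat).
Implicit Types Q A B : 'M[R]_d.

Definition incidence (p : 'I_d * 'I_d) : 'cV[R]_d :=
  delta_mx p.1 0 - delta_mx p.2 0.

Lemma sum_ltn_sym (F : 'I_d -> 'I_d -> R) :
  (forall u v, F u v = F v u) -> (forall u, F u u = 0) ->
  (\sum_(p : 'I_d * 'I_d | (p.1 < p.2)%N) F p.1 p.2) *+ 2 = \sum_u \sum_v F u v.
Proof.
move=> symF F0; rewrite pair_bigA /=.
rewrite [RHS](bigID (fun p : 'I_d * 'I_d => (p.1 < p.2)%N)) /= mulr2n.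
congr (_ + _).
pose swap (p : 'I_d * 'I_d) := (p.2, p.1).
rewrite [RHS](reindex_inj (h := swap)) /=; last by move=> [u v] [u' v'] [-> ->].
rewrite [RHS](bigID (fun p : 'I_d * 'I_d => p.1 == p.2)) /=.
rewrite [X in _ = X + _]big1 ?add0r => [|[u v] /= /andP[_ /eqP->]]; last exact: F0.
apply: eq_big => [[u v]|[u v] _] /=; last exact: symF.
by rewrite -leqNgt ltn_neqAle andbC.
Qed.

Lemma laplacian_sum Q : sym0 Q ->
  laplacian Q = \sum_(p : 'I_d * 'I_d | (p.1 < p.2)%N)
                  Q p.1 p.2 *: (incidence p *m (incidence p)^T).
Proof.
move=> [/matrixP symQ Q0]; apply/matrixP => x y; rewrite summxE.
pose F u v := Q u v * (((x == u)%:R - (x == v)%:R) * ((y == u)%:R - (y == v)%:R)).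
(* Doubling the sum over [u < v] gives a sum over all ordered pairs, in which the indicators can be
   summed out one index at a time. *)
have sumF : laplacian Q x y *+ 2 = \sum_u \sum_v F u v.
  have pick (z : 'I_d) (G : 'I_d -> R) : \sum_u (z == u)%:R * G u = G z.
    rewrite (bigD1 z) //= eqxx mul1r big1 ?addr0 // => u.
      by rewrite eq_sym => /negbTE ->; rewrite mul0r.
  have inner u : \sum_v F u v = (x == u)%:R * ((y == u)%:R * \sum_v Q u v)
      - (x == u)%:R * Q u y - (y == u)%:R * Q u x + (y == x)%:R * Q u x.
    rewrite -(pick y (Q u)) -(pick x (fun v => (y == v)%:R * Q u v)).
    rewrite -(pick x (Q u)) !mulr_sumr -!sumrB -big_split /=.
    by apply: eq_bigr => v _; rewrite /F; ring.
  rewrite (eq_bigr _ (fun u _ => inner u)) big_split !sumrB /= !pick -mulr_sumr.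
  have -> : \sum_u Q u x = \sum_u Q x u.
    by apply: eq_bigr => u _; rewrite -symQ mxE.
  rewrite -(symQ y x) mxE !mxE [\sum_v Q x v](bigD1 x) //= Q0 add0r eq_sym.
  by rewrite -mulr_natl; ring.
rewrite (_ : \sum_(p | _) _ =
    \sum_(p : 'I_d * 'I_d | (p.1 < p.2)%N) F p.1 p.2); last first.
  apply: eq_bigr => -[u v] _; rewrite !mxE big_ord1 !mxE /F /=.
  by rewrite !andbT.
apply: (mulIf (x := 2%:R)); rewrite ?pnatr_eq0 // !mulr_natr sumF sum_ltn_sym //.
  by move=> u v; rewrite /F -[Q u v]symQ mxE; ring.
by move=> u; rewrite /F Q0 mul0r.
Qed.

Lemma trmx_laplacian Q : sym0 Q -> (laplacian Q)^T = laplacian Q.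
Proof. by move=> [symQ _]; rewrite /laplacian linearB /= tr_diag_mx symQ. Qed.

Lemma laplacian_const Q c : sym0 Q ->
  laplacian Q *m (const_mx c : 'cV_d) = 0.
Proof.
move=> [_ Q0]; apply/colP => u; rewrite !mxE.
under eq_bigr => v _ do rewrite !mxE mulrBl.
rewrite sumrB (bigD1 u) //= eqxx [X in _ + X - _]big1 => [|v]; last first.
    by rewrite eq_sym => /negbTE ->; rewrite mul0r.
rewrite addr0 mulr1n mulr_suml [X in _ - X](bigD1 u) //= Q0 mul0r add0r.
by rewrite subrr.
Qed.

Lemma laplacianD Q Q' (h : R) :
  laplacian (Q + h *: Q') = laplacian Q + h *: laplacian Q'.
Proof.
apply/matrixP => u v; rewrite !mxE.
under eq_bigr => w _ do rewrite !mxE.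
rewrite big_split -mulr_sumr /= mulrnDl mulrBr mulrnAr; ring.
Qed.

Lemma hyperplane_incidence p : hyperplane (incidence p).
Proof.
rewrite /hyperplane /= /incidence linearB /= mulmxBl !trmx_delta -!rowE.
by rewrite !row_const subrr.
Qed.

(* [A (A^+ b) - b] is orthogonal to the ones vector and in the kernel of [A]. *)
Lemma mp_inverse_hyperplane A (b : 'cV_d) :
    A^T = A -> A *m (const_mx 1 : 'cV_d) = 0 -> posdef_on_hyperplane A ->
  hyperplane b -> A *m (mp_inverse A *m b) = b.
Proof.
move=> symA A1 posA hb; have [S1 S2 S3 S4] := mp_inverseP A.
set S := mp_inverse A in S1 S2 S3 S4 *.
have AAS : A *m (A *m S) = A.
  by rewrite -{1}symA -[A *m S]S3 -trmx_mul S1.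
apply/eqP; rewrite -subr_eq0; apply: contraT => z0.
have hz : hyperplane (A *m (S *m b) - b).
  rewrite /hyperplane /= linearB /= mulmxBl hb subr0.
  by rewrite trmx_mul symA -mulmxA A1 mulmx0.
have Az : A *m (A *m (S *m b) - b) = 0.
  by rewrite mulmxBr !mulmxA -(mulmxA A A S) AAS subrr.
by have := posA _ hz z0; rewrite -mulmxA Az mulmx0 mxE ltxx.
Qed.

(** The transpose satisfies the same four Penrose conditions, so uniqueness applies. *)
Lemma mp_inverse_sym A : A^T = A -> (mp_inverse A)^T = mp_inverse A.
Proof.
move=> symA; have := mp_inverseP A; move: (mp_inverse A) => S mpS.
apply: (moore_penrose_unique (A := A)) => //; case: mpS => S1 S2 S3 S4; split.
- by have := congr1 trmx S1; rewrite !trmx_mul symA mulmxA.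
- by have := congr1 trmx S2; rewrite !trmx_mul symA mulmxA.
- by rewrite trmx_mul trmxK symA -[LHS]S4 trmx_mul symA.
- by rewrite trmx_mul trmxK symA -[LHS]S3 trmx_mul symA.
Qed.

(** The diagonal terms [S x x] cancel in the alternating sum; the remaining [- 2 S x y] assemble
    into the bilinear form. *)
Lemma variogram_incidence Q (u v s t : 'I_d) : sym0 Q ->
  variogram Q s v - variogram Q u s - variogram Q t v + variogram Q u t =
  2 * ((incidence (u, v))^T *m mp_inverse (laplacian Q) *m incidence (s, t)) 0 0.
Proof.
move=> Q0; have /matrixP symS := mp_inverse_sym (trmx_laplacian Q0).
rewrite /variogram /=; set S := mp_inverse _ in symS *.
have SE x y : (\col_i S i i *m (const_mx 1 : 'cV_d)^T +
    (const_mx 1 : 'cV_d) *m (\col_i S i i)^T - S *+ 2) x y =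
    S x x + S y y - S x y *+ 2.
  by rewrite !mxE !big_ord1 !mxE mulr1 mul1r -mulr2n.
have -> : (incidence (u, v))^T = delta_mx 0 u - delta_mx 0 v.
  by rewrite /incidence linearB /= !trmx_delta.
rewrite !SE /incidence /= !mulmxBl !mulmxBr -!rowE -!colE !mxE.
have [-> ->] : S s v = S v s /\ S t v = S v t by split; rewrite -[LHS]symS mxE.
ring.
Qed.

End Laplacian.

(** * Positivity and inverse of the grounded Laplacian *)

Section GroundedLaplacian.
Variables (R : realType) (n : nat).
Implicit Types (Q : 'M[R]_n.+1) (x y b c : 'cV[R]_n.+1).

Definition ground : 'M[R]_n.+1 := 1%:M - delta_mx 0 0.

Lemma ground_root : (delta_mx 0 0 : 'M[R]_n.+1) *m ground = 0.
Proof. by rewrite /ground mulmxBr mulmx1 mul_delta_mx subrr. Qed.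

Lemma grounded_laplacianE Q :
  grounded_laplacian Q = ground *m laplacian Q + delta_mx 0 0.
Proof.
rewrite /ground mulmxBl mul1mx /grounded_laplacian; move: (laplacian Q) => L.
apply/matrixP => u v; rewrite !mxE (bigD1 0) //= big1 ?addr0 => [|w w0]; last first.
  by rewrite !mxE (negbTE w0) andbF mul0r.
rewrite !mxE eqxx andbT.
by case: eqVneq => [->|u0] /=; rewrite ?mul1r ?subrr ?add0r // mul0r subr0 addr0.
Qed.

Lemma root_mul x : x 0 0 = 0 -> x^T *m (delta_mx 0 0 : 'M[R]_n.+1) = 0.
Proof.
move=> x0; apply/rowP => v; rewrite !mxE big1 // => w _.
by rewrite !mxE; case: eqVneq => [->|_]; rewrite ?x0 ?mul0r ?mulr0.
Qed.

Lemma delta_root_mul x : ((delta_mx 0 0 : 'M[R]_n.+1) *m x) 0 0 = x 0 0.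
Proof.
rewrite mxE (bigD1 0) //= big1 ?addr0 => [|w w0]; last first.
  by rewrite !mxE (negbTE w0) mul0r.
by rewrite !mxE mul1r.
Qed.

(** Subtracting the mean [m] moves [x] into the hyperplane without changing the quadratic form,
    since constants are in the kernel. The result is nonzero because a constant [x] with [x 0 0 = 0]
    is zero. *)
Lemma laplacian_gt0 Q x : calQ Q -> x 0 0 = 0 -> x != 0 ->
  0 < (x^T *m laplacian Q *m x) 0 0.
Proof.
move=> [Q0 posQ] x00 xN0.
pose m := n.+1%:R^-1 * \sum_i x i 0.
pose x' : 'cV_n.+1 := x - const_mx m.
have hx' : hyperplane x'.
  apply/matrixP => i j; rewrite !ord1 !mxE.
  under eq_bigr => k _ do rewrite !mxE mulr1.
  rewrite sumrB sumr_const card_ord -mulr_natl /m mulVKf ?pnatr_eq0 //.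
  by rewrite subrr.
have x'N0 : x' != 0.
  apply: contraNneq xN0 => x'0.
  have xE : x = const_mx m by apply/eqP; rewrite -subr_eq0; apply/eqP.
  by move: x00; rewrite xE mxE => ->; apply/eqP/matrixP => i j; rewrite !mxE.
have := posQ _ hx' x'N0; rewrite -mulmxA /x' mulmxBr laplacian_const // subr0.
rewrite linearB /= mulmxBl mulmxA -[(const_mx m)^T *m _]trmxK trmx_mul trmxK.
rewrite [(laplacian Q *m x)^T]trmx_mul trmx_laplacian //.
by rewrite -(mulmxA x^T _ (const_mx m)) laplacian_const // mulmx0 trmx0 subr0.
Qed.

(* The determinant does not vanish along the segment from the identity to the
   grounded Laplacian, hence keeps its sign. *)
Lemma det_grounded_gt0 Q : calQ Q -> 0 < \det (grounded_laplacian Q).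
Proof.
move=> calQQ; set M := grounded_laplacian Q.
(* The sign is chosen so that [p] starts at -1 and, if the claim fails, ends nonnegative, as
   [poly_ivt] expects. *)
pose p := - \det (pencil 1%:M (M - 1%:M)).
rewrite ltNge; apply/negP => M0.
have [|t /andP[t0 t1]] := @poly_ivt R p 0 1 ler01.
  rewrite /p !hornerN !horner_det_pencil scale0r scale1r addr0 det1 addrC subrK.
  by rewrite oppr_le0 ler01 oppr_ge0.
rewrite /root /p hornerN oppr_eq0 horner_det_pencil -det_tr => /det0P[v vN0 vA].
pose y := v^T.
have {vA} : (1%:M + t *: (M - 1%:M)) *m y = 0.
  by apply: trmx_inj; rewrite trmx_mul trmxK vA trmx0.
rewrite /M grounded_laplacianE mulmxDl mul1mx -scalemxAl mulmxBl mulmxDl mul1mx.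
move=> Ay.
have yN0 : y != 0 by apply: contraNneq vN0 => y0; rewrite -[v]trmxK -/y y0 trmx0.
(* Both ends of the segment have the unit vector as root row, so the root coordinate of [Ay] is
   [y 0 0 = 0]. *)
have y00 : y 0 0 = 0.
  have := congr1 (fun z => ((delta_mx 0 0 : 'M[R]_n.+1) *m z) 0 0) Ay.
  rewrite mulmx0 [X in _ = X]mxE mulmxDr -scalemxAr mulmxBr mulmxDr !mulmxA.
  rewrite ground_root !mul0mx add0r mul_delta_mx subrr scaler0 addr0.
  by rewrite delta_root_mul.
(* Pairing with [y] equates to 0 a convex combination, with weights [1 - t] and [t], of the positive
   numbers [y^T y] and [y^T L y], where [L] is the Laplacian. *)
have := congr1 (fun z => (y^T *m z) 0 0) Ay.
rewrite mulmx0 [X in _ = X]mxE mulmxDr -scalemxAr mulmxBr mulmxDr !mulmxA.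
have -> : y^T *m ground = y^T by rewrite /ground mulmxBr mulmx1 root_mul ?subr0.
rewrite root_mul // mul0mx addr0.
move: (laplacian_gt0 calQQ y00 yN0).
have : 0 < (y^T *m y) 0 0.
  have yy k : 0 <= y^T 0 k * y k 0 by rewrite mxE -expr2 sqr_ge0.
  rewrite mxE lt_def sumr_ge0 ?andbT //; apply: contra yN0 => /eqP yy0.
  apply/eqP/colP => k; have := psumr_eq0P (fun k _ => yy k) yy0 (i := k) isT.
  by rewrite !mxE => /eqP; rewrite mulf_eq0 orbb => /eqP.
move: ((y^T *m laplacian Q *m y)) (y^T *m y) => a b a0 b0.
by rewrite !mxE => e; nra.
Qed.

(** Shifting [mp_inverse (laplacian Q) *m b] by a constant so that its root coordinate is 0 solves
    the grounded system with right-hand side [ground *m b]; the shift is invisible to [c], which is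
    orthogonal to constants. *)
Lemma grounded_inverse_incidence Q b c : calQ Q ->
    hyperplane b -> hyperplane c ->
  (c^T *m invmx (grounded_laplacian Q) *m ground *m b) 0 0 =
  (c^T *m mp_inverse (laplacian Q) *m b) 0 0.
Proof.
move=> calQQ hb hc; have [Q0 posQ] := calQQ.
set M := grounded_laplacian Q.
have uM : M \in unitmx by rewrite unitmxE unitfE gt_eqF // det_grounded_gt0.
pose y := mp_inverse (laplacian Q) *m b.
pose y' : 'cV_n.+1 := y - const_mx (y 0 0).
have My' : M *m y' = ground *m b.
  rewrite /M grounded_laplacianE mulmxDl -mulmxA mulmxBr laplacian_const // subr0.
  rewrite mp_inverse_hyperplane ?trmx_laplacian ?laplacian_const //.
  rewrite [X in _ + X](_ : _ = 0) ?addr0 //.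
  rewrite -[LHS]trmxK trmx_mul trmx_delta root_mul ?trmx0 //.
  by rewrite !mxE subrr.
rewrite -!mulmxA -My' mulKmx // /y' mulmxBr.
have -> : c^T *m const_mx (y 0 0) = 0 :> 'M[R]_1.
  by rewrite -[y 0 0]mulr1 -scalemx_const -scalemxAr hc scaler0.
by rewrite subr0.
Qed.

End GroundedLaplacian.

(** * Directional derivatives of the colored log-likelihood *)

Lemma is_derive_line (R : realType) r (f : 'rV[R]_r -> R) (a v : 'rV[R]_r)
    (df : R) :
  is_derive (0 : R) 1 (fun h : R => f (h *: v + a)) df -> is_derive a v f df.
Proof.
have E : (fun h : R => h^-1 *: ((f \o shift a) (h *: v) - f a)) =
    (fun h : R => h^-1 *: (((fun h : R => f (h *: v + a)) \o shift 0) (h *: 1)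
                          - f (0 *: v + a))).
  by apply/funext => h /=; rewrite addr0 [h *: 1]mulr1 scale0r add0r.
case=> df1 df2; apply: DeriveDef; first by rewrite /derivable E.
by rewrite /derive E.
Qed.

Section Colored.
Variables (R : realType) (d r : nat) (E : {set {set 'I_d}}).
Variable lam : {set 'I_d} -> 'I_r.
Hypothesis simple_E : simple_graph E.
Implicit Types omega v : 'rV[R]_r.

Lemma Qmx_sym0 omega : sym0 (Qmx E lam omega).
Proof.
split; first by apply/matrixP => u v; rewrite !mxE edge_sym.
move=> u; rewrite mxE; case: ifP => // /(forall_inP simple_E).
by rewrite /edge /= finset.setUid cards1.
Qed.

Lemma QmxD omega v (h : R) :
  Qmx E lam (h *: v + omega) = Qmx E lam omega + h *: Qmx E lam v.
Proof.
by apply/matrixP => u w; rewrite !mxE; case: ifP; rewrite ?mulr0 ?addr0 // addrC.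
Qed.

Definition color_laplacian (j : 'I_r) : 'M[R]_d :=
  laplacian (Qmx E lam (delta_mx 0 j)).

Lemma color_laplacianE j : color_laplacian j =
  \sum_(p in edges E | lam (edge p) == j) incidence R p *m (incidence R p)^T.
Proof.
rewrite /color_laplacian laplacian_sum; last exact: Qmx_sym0.
rewrite [RHS](eq_bigl (fun p : 'I_d * 'I_d => (p.1 < p.2)%N &&
    ((edge p \in E) && (lam (edge p) == j)))); last first.
  by move=> p; rewrite inE andbA.
rewrite big_mkcondr; apply: eq_bigr => -[u v] _ /=; rewrite !mxE eqxx /=.
case: ifP => _ /=; rewrite ?scale0r //.
by case: (_ == j); rewrite ?scale1r ?scale0r.
Qed.

(** Cyclicity of the trace splits each product of two rank-one terms into two scalars. They are kept
    apart because [K] need not be symmetric. *)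
Lemma trace_color_laplacian (K : 'M[R]_d) (i j : 'I_r) :
  \tr (K *m color_laplacian i *m K *m color_laplacian j) =
  \sum_(p in edges E | lam (edge p) == i) \sum_(q in edges E | lam (edge q) == j)
    ((incidence R p)^T *m K *m incidence R q) 0 0 *
    ((incidence R q)^T *m K *m incidence R p) 0 0.
Proof.
rewrite (color_laplacianE i) mulmx_sumr mulmx_suml mulmx_suml raddf_sum.
apply: eq_bigr => p _ /=; rewrite (color_laplacianE j) mulmx_sumr raddf_sum.
apply: eq_bigr => q _ /=.
set x := incidence R p; set y := incidence R q.
have -> : K *m (x *m x^T) *m K *m (y *m y^T) =
    (K *m x) *m (x^T *m K *m y *m y^T) by rewrite !mulmxA.
rewrite mxtrace_mulC.
have -> : x^T *m K *m y *m y^T *m (K *m x) =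
    (x^T *m K *m y) *m (y^T *m K *m x) by rewrite !mulmxA.
by rewrite /mxtrace big_ord1 mxE big_ord1.
Qed.

End Colored.

Section ColoredDerivatives.
Variables (R : realType) (n r : nat) (E : {set {set 'I_n.+1}}).
Variable lam : {set 'I_n.+1} -> 'I_r.
Hypothesis simple_E : simple_graph E.
Implicit Types (omega v t : 'rV[R]_r).

Let M omega := grounded_laplacian (Qmx E lam omega).
Let B j := ground R n *m color_laplacian R E lam j.

Lemma grounded_line omega j (h : R) :
  M (h *: delta_mx 0 j + omega) = M omega + h *: B j.
Proof.
rewrite /M QmxD !grounded_laplacianE laplacianD mulmxDr -scalemxAr.
by rewrite addrAC.
Qed.

Lemma loglikE t omega : loglik E lam t omega =
  2^-1 * ln (\det (M omega)) + \sum_(i < r) t 0 i * omega 0 i.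
Proof. by rewrite /loglik matrix_tree //; exact: Qmx_sym0. Qed.

(** Assuming only a positive determinant, an open condition, makes the formula available at all
    nearby points of a line, as the second derivative requires. *)
Lemma derive_loglik t omega j : 0 < \det (M omega) ->
  'D_(delta_mx 0 j) (loglik E lam t) omega =
  2^-1 * \tr (invmx (M omega) *m B j) + t 0 j.
Proof.
move=> M0; apply: derive_val; apply: is_derive_line.
set c := \sum_(i < r) t 0 i * omega 0 i.
have -> : (fun h : R => loglik E lam t (h *: delta_mx 0 j + omega)) =
    (fun h : R => 2^-1 * ln (\det (M omega + h *: B j))) +
    (fun h : R => h * t 0 j + c).
  apply/funext => h /=; rewrite loglikE grounded_line; congr (_ + _).
  under eq_bigr => i _ do rewrite !mxE mulrDr mulrCA.
  rewrite big_split -mulr_sumr /=; congr (_ * _ + _).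
  rewrite (bigD1 j) //= eqxx mulr1 big1 ?addr0 // => i /negbTE ->.
  by rewrite mulr0.
apply: is_deriveD.
  have := is_derive_ln_det (B j) M0 => D.
  exact: is_deriveZ.
have -> : (fun h : R => h * t 0 j + c) = horner (t 0 j *: 'X + c%:P).
  by apply/funext => h; rewrite !hornerE mulrC.
by apply: is_derive_eq; rewrite derivD derivZ derivX derivC !hornerE.
Qed.

Lemma derive2_loglik t omega i j : 0 < \det (M omega) ->
  'D_(delta_mx 0 i) ('D_(delta_mx 0 j) (loglik E lam t)) omega =
  - (2^-1 * \tr (invmx (M omega) *m B i *m invmx (M omega) *m B j)).
Proof.
move=> M0; apply: derive_val; apply: is_derive_line.
have D := is_derive_tr_inv (B i) (B j) M0.
apply: (@near_eq_is_derive _ _ _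
  ((fun h : R => 2^-1 * \tr (invmx (M omega + h *: B i) *m B j)) + cst (t 0 j))).
  apply: filterS (det_gt0_near (B i) M0) => h h0.
  by rewrite derive_loglik grounded_line.
have D' : is_derive (0 : R) 1
    (fun h : R => 2^-1 * \tr (invmx (M omega + h *: B i) *m B j))
    (2^-1 * - \tr (invmx (M omega) *m B i *m invmx (M omega) *m B j)).
  exact: is_deriveZ.
by rewrite -mulrN -[X in is_derive _ _ _ X]addr0; apply: is_deriveD.
Qed.

End ColoredDerivatives.

Theorem lemma5p1 (R : realType) (d r : nat)
    (E : {set {set 'I_d}}) (hE : simple_graph E)
    (lam : {set 'I_d} -> 'I_r)
    (omega : 'rV[R]_r) (homega : Omega E lam omega)
    (Gt : 'M[R]_d) (hGt : sym0 Gt) (i j : 'I_r) :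
  information E lam Gt omega i j =
    8^-1 * \sum_(uv in edges E | lam (edge uv) == i)
             \sum_(st in edges E | lam (edge st) == j)
               let: (u, v) := uv in let: (s, t) := st in
               (Gamma E lam omega s v - Gamma E lam omega u s
                - Gamma E lam omega t v + Gamma E lam omega u t) ^+ 2.
Proof.
(* Grounding needs a vertex. For [d = 0] the log-likelihood is constant and the edge sums are empty,
   so both sides are 0. *)
case: d => [|n] in E hE lam homega Gt hGt *.
  have no_edges (T : {set {set 'I_0}}) : edges T = finset.set0.
    by apply/setP => -[[]].
  rewrite no_edges [in RHS]big1 ?mulr0; last by move=> p; rewrite inE.
  have -> : information E lam Gt omega =
      - hessian (fun=> loglik E lam 0 0) omega.
    congr (- hessian _ omega); apply/funext => w; rewrite /loglik.
    congr (_ * ln _ + _).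
      by apply: eq_bigr => T _; rewrite no_edges !big_pred0 // => p; rewrite inE.
    apply: eq_bigr => k _; rewrite !mxE no_edges big_pred0 ?mulr0 ?oppr0 ?mul0r //.
    by move=> p; rewrite inE.
  rewrite !mxE (_ : 'D_(delta_mx 0 j) _ = cst 0) ?derive_cst ?oppr0 //.
  by apply/funext => w; rewrite derive_cst.
have det0 := det_grounded_gt0 homega.
have Q0 := Qmx_sym0 lam hE omega.
rewrite !mxE derive2_loglik // opprK.
set X := invmx _; pose K := X *m ground R n.
have -> : X *m (ground R n *m color_laplacian R E lam i) *m X *m
    (ground R n *m color_laplacian R E lam j) =
    K *m color_laplacian R E lam i *m K *m color_laplacian R E lam j.
  by rewrite /K !mulmxA.
rewrite trace_color_laplacian // !mulr_sumr; apply: eq_bigr => -[u v] _.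
rewrite !mulr_sumr; apply: eq_bigr => -[s t] _.
rewrite /Gamma variogram_incidence // /K !mulmxA.
rewrite !grounded_inverse_incidence //; try exact: hyperplane_incidence.
set S := mp_inverse _.
(* The two scalars are transposes of each other, so their product is a square;
   [1/2 a^2 = 1/8 (2a)^2] accounts for the constant. *)
have <- : ((incidence R (u, v))^T *m S *m incidence R (s, t))^T =
    (incidence R (s, t))^T *m S *m incidence R (u, v).
  by rewrite !trmx_mul trmxK mp_inverse_sym ?trmx_laplacian // mulmxA.
by rewrite [_^T 0 0]mxE; field.
Qed.
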